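(* Let $T$ be a complete first-order theory. If $T$ is weakly o-minimal, then $T$ is fully VC-minimal.
   Context: $\mathfrak{C}$ denotes a monster model of $T$. ''Formula'' means a formula without parameters; $x$ denotes a single variable, $\overline{y}$ a finite tuple of variables, $\mathrm{lg}(\overline{y})$ its length. Weakly o-minimal: the language contains a symbol $<$ interpreted as a linear order, and in every model of $T$ every subset of the universe definable with parameters is a finite union of $<$-convex sets. Independence dimension $\le 1$: a family $\mathcal{A}$ of subsets of a set $X$ has independence dimension $\le 1$ with respect to $X$ if there are no two distinct $B_0, B_1 \in \mathcal{A}$ such that all four sets $B_0^{s} \cap B_1^{t}$ ($s,t \in \{0,1\}$) are nonempty, where $B^1 = B$ and $B^0 = X \setminus B$. Fully VC-minimal: $T$ is fully VC-minimal if there is a family of formulas $\Psi$, each of which has at least $x$ as a free variable (possibly as a dummy variable), such that: (i) the set $\mathcal{A}_\Psi = \{\psi(\mathfrak{C};\overline{b}) : \psi(x;\overline{y}) \in \Psi, \overline{b} \in \mathfrak{C}^{\mathrm{lg}(\overline{y})}\}$ has independence dimension $\le 1$ with respect to $\mathfrak{C}$; and (ii) for every formula $\varphi(x;\overline{y})$ there is a boolean combination $\psi(x;\overline{y})$ of formulas from $\Psi$ with variables $(x;\overline{y})$ such that $\varphi(x;\overline{y})$ is $T$-equivalent to $\psi(x;\overline{y})$. *)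

(* Defs.v *)
From mathcomp Require Import all_boot.
From mathcomp Require Import boolp classical_sets functions cardinality.

Set Implicit Arguments.
Unset Strict Implicit.
Unset Printing Implicit Defensive.

Local Open Scope classical_set_scope.
Local Open Scope card_scope.

Record language := Language {
  fun_symb : nat -> Type;   (* indexed by arity; constants have arity 0 *)
  rel_symb : nat -> Type
}.

(* [term L n] and [formula L n]: the free variables are among the n variables
   indexed by ['I_n], possibly as dummy variables.  A formula phi(x; ybar) with
   lg(ybar) = n is an element of [formula L n.+1], the variable x having index
   [ord0]. *)
Inductive term (L : language) (n : nat) : Type :=
| tvar of 'I_n
| tapp k of fun_symb L k & ('I_k -> term L n).

(* [fex] binds the variable of index [ord0] of its body. *)
Inductive formula (L : language) (n : nat) : Type :=
| feq of term L n & term L n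
| fatom k of rel_symb L k & ('I_k -> term L n)
| fneg of formula L n
| fand of formula L n & formula L n
| fex of formula L n.+1.

Definition sentence (L : language) := formula L 0.

Record structure (L : language) := Structure {
  dom :> Type;
  dom_inhabited : inhabited dom;
  fun_interp : forall k, fun_symb L k -> ('I_k -> dom) -> dom;
  rel_interp : forall k, rel_symb L k -> ('I_k -> dom) -> Prop
}.

(* the tuple (a, b_0, ..., b_(n-1)) *)
Definition scons (X : Type) (n : nat) (a : X) (b : 'I_n -> X) : 'I_n.+1 -> X :=
  fun i => if unlift ord0 i is Some j then b j else a.

Fixpoint eval (L : language) (M : structure L) (n : nat) (v : 'I_n -> M)
    (t : term L n) : M :=
  match t with
  | tvar i => v i
  | tapp _ f args => fun_interp f (fun i => eval v (args i))
  end.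

Fixpoint sat (L : language) (M : structure L) (n : nat) (v : 'I_n -> M)
    (phi : formula L n) : Prop :=
  match phi with
  | feq s t => eval v s = eval v t
  | fatom _ r args => rel_interp r (fun i => eval v (args i))
  | fneg p => ~ sat v p
  | fand p q => sat v p /\ sat v q
  | fex p => exists a : M, sat (scons a v) p
  end.

Definition no_vars (X : Type) : 'I_0 -> X :=
  fun i => False_rect X (notF (ltn_ord i)).

Definition sat_sentence (L : language) (M : structure L) (s : sentence L) : Prop :=
  sat (@no_vars M) s.

Definition theory (L : language) := set (sentence L).

Definition is_model (L : language) (T : theory L) (M : structure L) : Prop :=
  forall s, T s -> sat_sentence M s.

Definition entails (L : language) (T : theory L) (s : sentence L) : Prop :=
  forall M : structure L, is_model T M -> sat_sentence M s.

Definition complete_theory (L : language) (T : theory L) : Prop :=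
  (exists M : structure L, is_model T M) /\
  (forall s : sentence L, entails T s \/ entails T (fneg s)).

Definition T_equivalent (L : language) (T : theory L) (n : nat)
    (phi psi : formula L n) : Prop :=
  forall M : structure L, is_model T M ->
  forall v : 'I_n -> M, sat v phi <-> sat v psi.

(* phi(M; b) *)
Definition fiber (L : language) (M : structure L) (n : nat)
    (phi : formula L n.+1) (b : 'I_n -> M) : set M :=
  [set a | sat (scons a b) phi].

Definition definable_with_parameters (L : language) (M : structure L)
    (S : set M) : Prop :=
  exists (n : nat) (phi : formula L n.+1) (b : 'I_n -> M), S = fiber phi b.

(* A cardinal is represented by a type [K] of that cardinality.  [small K A]
   says that |A| < |K|; by the axiom of choice this is the failure of
   |K| <= |A|. *)
Definition small (K X : Type) (A : set X) : Prop := ~ ([set: K] #<= A).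

(* A formula in n type variables with parameters from M: a formula together
   with, for each of its variables, either one of the type variables or an
   element of M to be put in its place. *)
Record pformula (L : language) (M : structure L) (n : nat) := PFormula {
  pf_arity : nat;
  pf_formula : formula L pf_arity;
  pf_subst : 'I_pf_arity -> 'I_n + M
}.
Arguments pf_subst {L M n} p i.

Definition pf_over (L : language) (M : structure L) (n : nat) (A : set M)
    (q : pformula M n) : Prop :=
  forall i c, pf_subst q i = inr c -> A c.

Definition pf_sat (L : language) (M : structure L) (n : nat) (a : 'I_n -> M)
    (q : pformula M n) : Prop :=
  sat (fun i => match pf_subst q i with inl j => a j | inr c => c end)
      (pf_formula q).

Definition saturated (K : Type) (L : language) (M : structure L) : Prop :=
  forall (A : set M) (n : nat) (p : set (pformula M n)),
    small K A ->
    p `<=` pf_over A ->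
    (forall F : set (pformula M n), finite_set F -> F `<=` p ->
       exists a : 'I_n -> M, F `<=` pf_sat a) ->
    exists a : 'I_n -> M, p `<=` pf_sat a.

Definition automorphism (L : language) (M : structure L) (g : M -> M) : Prop :=
  [/\ bijective g,
      forall k (f : fun_symb L k) (a : 'I_k -> M),
        g (fun_interp f a) = fun_interp f (g \o a) &
      forall k (r : rel_symb L k) (a : 'I_k -> M),
        rel_interp r a <-> rel_interp r (g \o a)].

(* The values of f outside A are irrelevant. *)
Definition partial_elementary (L : language) (M : structure L) (A : set M)
    (f : M -> M) : Prop :=
  forall (n : nat) (phi : formula L n) (a : 'I_n -> M),
    (forall i, A (a i)) -> (sat a phi <-> sat (f \o a) phi).

Definition strongly_homogeneous (K : Type) (L : language) (M : structure L) : Prop :=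
  forall (A : set M) (f : M -> M),
    small K A -> partial_elementary A f ->
    exists2 g : M -> M, automorphism g & forall c, A c -> g c = f c.

(* There are |L| + aleph_0 formulas, so the first clause on [K] says that the
   cardinal is uncountable and greater than |L|. *)
Definition monster_model (L : language) (T : theory L) (C : structure L) : Prop :=
  is_model T C /\
  exists K : Type,
    [/\ small K [set: {n : nat & formula L n}],
        saturated K C &
        strongly_homogeneous K C].

Definition pair_args (X : Type) (a b : X) : 'I_2 -> X :=
  fun i => if i == ord0 then a else b.

Definition rel2 (L : language) (M : structure L) (lt : rel_symb L 2) (a b : M) : Prop :=
  rel_interp lt (pair_args a b).

Definition strict_linear_order (X : Type) (R : X -> X -> Prop) : Prop :=
  [/\ forall a, ~ R a a,
      forall a b c, R a b -> R b c -> R a c &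
      forall a b, [\/ R a b, a = b | R b a]].

Definition convex (X : Type) (R : X -> X -> Prop) (S : set X) : Prop :=
  forall a b c, S a -> S b -> R a c -> R c b -> S c.

Definition finite_union_of_convex (X : Type) (R : X -> X -> Prop) (S : set X) : Prop :=
  exists (k : nat) (I : 'I_k -> set X),
    (forall i, convex R (I i)) /\ S = \bigcup_(i in [set: 'I_k]) I i.

Definition weakly_o_minimal (L : language) (T : theory L) : Prop :=
  exists lt : rel_symb L 2,
    forall M : structure L, is_model T M ->
      strict_linear_order (@rel2 L M lt) /\
      (forall S : set M, definable_with_parameters S ->
         finite_union_of_convex (@rel2 L M lt) S).

(* B^1 = B and B^0 = X \ B *)
Definition set_sign (X : Type) (B : set X) (s : bool) : set X :=
  if s then B else ~` B.

Definition independence_dimension_le1 (X : Type) (A : set (set X)) : Prop :=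
  ~ exists B0 B1 : set X,
      [/\ A B0, A B1, B0 <> B1 &
          forall s t : bool, (set_sign B0 s `&` set_sign B1 t) !=set0].

Inductive boolean_combination (L : language) (n : nat)
    (P : set (formula L n)) : formula L n -> Prop :=
| bc_base psi : P psi -> boolean_combination P psi
| bc_neg psi : boolean_combination P psi -> boolean_combination P (fneg psi)
| bc_and psi1 psi2 : boolean_combination P psi1 -> boolean_combination P psi2 ->
    boolean_combination P (fand psi1 psi2).

(* A family Psi of formulas psi(x; ybar) is given by its members with
   lg(ybar) = n, for each n. *)
Definition formula_family (L : language) := forall n : nat, set (formula L n.+1).

(* the family A_Psi of the sets psi(M; b) *)
Definition fibers (L : language) (M : structure L) (Psi : formula_family L) :
    set (set M) :=
  [set S | exists (n : nat) (psi : formula L n.+1) (b : 'I_n -> M),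
             Psi n psi /\ S = fiber psi b].
Arguments fibers {L} M Psi _.

(* C is the fixed monster model of T.  Adding dummy variables to the members of
   Psi, or renaming or identifying their parameter variables, adds no set to
   A_Psi; hence taking, for the formulas of Psi with variables (x; ybar), the
   members of [Psi n] only is no restriction on the existence of Psi. *)
Definition fully_VC_minimal (L : language) (T : theory L) (C : structure L) : Prop :=
  exists Psi : formula_family L,
    independence_dimension_le1 (fibers C Psi) /\
    (forall (n : nat) (phi : formula L n.+1),
       exists psi : formula L n.+1,
         boolean_combination (Psi n) psi /\ T_equivalent T phi psi).

(* Main.v *)
Require Import Defs.
From mathcomp Require Import all_boot.
From mathcomp Require Import boolp classical_sets functions cardinality.

(** Take for Psi the formulas whose fibers are upward closed: of two upward
    closed sets of a linear order one contains the other, so the independence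
    dimension is at most 1.  Given phi(x; y), let U_k(x; y) say that there is a
    chain z_1 <= ... <= z_k <= x along which phi alternates, starting with
    phi false at z_1.  Weak o-minimality makes each chain in each fiber bounded,
    saturation makes the bound N uniform, and completeness transfers it to all
    models.  As phi(x) holds iff the largest k with U_k(x) is even,
    it is equivalent to U_0 /\ ~ (U_1 /\ ~ (U_2 /\ ... ~ U_N)). *)

Set Implicit Arguments.
Unset Strict Implicit.
Unset Printing Implicit Defensive.

Local Open Scope classical_set_scope.

(** * Tuples and renaming of variables *)

Section Scons.
Variables (X : Type) (n : nat).
Implicit Types (a : X) (b : 'I_n -> X).

Lemma scons0 a b : scons a b ord0 = a.
Proof. by rewrite /scons unlift_none. Qed.

Lemma sconsS a b i : scons a b (lift ord0 i) = b i.
Proof. by rewrite /scons liftK. Qed.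

Lemma scons_eta (v : 'I_n.+1 -> X) : v = scons (v ord0) (fun i => v (lift ord0 i)).
Proof.
by apply/funext => i; case: (unliftP ord0 i) => [j|] ->; rewrite ?sconsS ?scons0.
Qed.

End Scons.

Section Renaming.
Variables (L : language) (M : structure L).

Fixpoint rename_term n m (r : 'I_n -> 'I_m) (t : term L n) : term L m :=
  match t with
  | tvar i => tvar L (r i)
  | tapp _ f args => tapp f (fun i => rename_term r (args i))
  end.

Definition rename_lift n m (r : 'I_n -> 'I_m) : 'I_n.+1 -> 'I_m.+1 :=
  scons ord0 (fun i => lift ord0 (r i)).

Fixpoint rename n m (r : 'I_n -> 'I_m) (phi : formula L n) : formula L m :=
  match phi with
  | feq s t => feq (rename_term r s) (rename_term r t)
  | fatom _ R args => fatom R (fun i => rename_term r (args i))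
  | fneg p => fneg (rename r p)
  | fand p q => fand (rename r p) (rename r q)
  | fex p => fex (rename (rename_lift r) p)
  end.

Lemma eval_rename n m (r : 'I_n -> 'I_m) (v : 'I_m -> M) t :
  eval v (rename_term r t) = eval (v \o r) t.
Proof.
elim: t => //= k f args IH; congr fun_interp.
by apply/funext => i; exact: IH.
Qed.

Lemma scons_rename_lift n m (r : 'I_n -> 'I_m) (a : M) (v : 'I_m -> M) :
  scons a v \o rename_lift r = scons a (v \o r).
Proof.
rewrite [LHS]scons_eta /= /rename_lift scons0 scons0; congr scons.
by apply/funext => i; rewrite !sconsS.
Qed.

Lemma sat_rename n (phi : formula L n) m (r : 'I_n -> 'I_m) (v : 'I_m -> M) :
  sat v (rename r phi) <-> sat (v \o r) phi.
Proof.
elim: phi m r v => {n} /= [n s t|n k R args|n p IH|n p IHp q IHq|n p IH] m r v.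
- by rewrite !eval_rename.
- suff -> : (fun i => eval v (rename_term r (args i))) =
            (fun i => eval (v \o r) (args i)) by [].
  by apply/funext => i; rewrite eval_rename.
- by rewrite IH.
- by rewrite IHp IHq.
- by split=> -[a]; [rewrite IH scons_rename_lift | rewrite -scons_rename_lift -IH];
    exists a.
Qed.

End Renaming.

(** * Transfer between models and compactness *)

Fixpoint ex_closure (L : language) n : formula L n -> sentence L :=
  match n with
  | 0 => id
  | _.+1 => fun phi => ex_closure (fex phi)
  end.

Lemma sat_ex_closure (L : language) (M : structure L) n (phi : formula L n) :
  sat_sentence M (ex_closure phi) <-> exists v : 'I_n -> M, sat v phi.
Proof.
elim: n phi => [|n IH] phi /=.
  split=> [?|[v]]; first by exists (@no_vars M).
  suff -> : v = @no_vars M by [].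
  by apply/funext => -[].
rewrite IH; split=> [[v [a va]]|[v]]; first by exists (scons a v).
by rewrite (scons_eta v) => va; exists (fun i => v (lift ord0 i)), (v ord0).
Qed.

(** The existential closure of [phi] is decided by [T]; it fails in [C], so its negation holds in
    every model. *)
Lemma complete_theory_transfer (L : language) (T : theory L) (C M : structure L)
    n (phi : formula L n) :
  complete_theory T -> is_model T C -> is_model T M ->
  (forall v : 'I_n -> C, ~ sat v phi) -> forall v : 'I_n -> M, ~ sat v phi.
Proof.
move=> [_ complT] TC TM nC v vphi.
have [/(_ C TC)/sat_ex_closure[w /nC]//|/(_ M TM)] := complT (ex_closure phi).
by apply; apply/sat_ex_closure; exists v.
Qed.

(* The countable type { p k y : k } is over the empty set, whose smallness only
   asks for a nonempty cardinal. *)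
Lemma monster_compactness (L : language) (T : theory L) (C : structure L) n
    (p : nat -> formula L n) :
  monster_model T C ->
  (forall k (v : 'I_n -> C), sat v (p k.+1) -> sat v (p k)) ->
  (forall k, exists v : 'I_n -> C, sat v (p k)) ->
  exists v : 'I_n -> C, forall k, sat v (p k).
Proof.
move=> [_ [K [Ksmall Ksat _]]] p_decr p_sat.
have p_mono v j k : j <= k -> sat v (p k) -> sat (M := C) v (p j).
  move=> /subnK <-; elim: (k - j) => // i IH; rewrite addSn => /p_decr; exact: IH.
pose g k : pformula C n := PFormula (p k) (fun i => inl i).
have [||F Ffin Fg|v vp] := Ksat set0 n (range g).
- move=> K0; apply: Ksmall; apply: card_le_trans K0 _.
  exact: card_ge0.
- by move=> _ [k _ <-] i c.
(* Choosing an index for each formula of the type lets the largest index over [F] give a single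
   [p N] that implies all of [F]. *)
- have [h hg] : exists h, forall q, range g q -> g (h q) = q.
    have /choice[h hg] : forall q, exists k, range g q -> g k = q.
      move=> q; have [[k _ <-]|nq] := pselect (range g q); first by exists k.
      by exists 0.
    by exists h.
  have [N hN] : exists N, forall q, F q -> h q <= N.
    have /finite_seqP[s sE] := finite_image h Ffin.
    exists (\max_(i <- s) i) => q Fq.
    have : [set` s] (h q) by rewrite -sE; exists q.
    by move=> /= qs; exact: (leq_bigmax_seq (P := xpredT) (F := id)).
  have [v vN] := p_sat N; exists v => q Fq.
  rewrite -(hg q (Fg q Fq)); exact: p_mono (hN q Fq) vN.
- by exists v => k; apply: (vp (g k)); exists k.
Qed.

(** * Upward closed sets and alternating chains in a linear order *)

Section LinearOrder.
Variables (X : Type) (R : X -> X -> Prop).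
Hypothesis Rlin : strict_linear_order R.

Lemma nlt_trans a b c : ~ R b a -> ~ R c b -> ~ R c a.
Proof.
have [_ Rtrans Rtot] := Rlin => nba ncb ca.
by case: (Rtot a b) => [ab|ab|//]; apply: ncb; [apply: Rtrans ca ab | rewrite -ab].
Qed.

Definition upward_closed (S : set X) := forall a b, S a -> ~ R b a -> S b.

Lemma upward_closed_independence_dimension (A : set (set X)) :
  (forall S, A S -> upward_closed S) -> independence_dimension_le1 A.
Proof.
have [Rirr Rtrans _] := Rlin.
move=> Aup [B0 [B1 [/Aup up0 /Aup up1 _ Bst]]].
have [a /= [B0a nB1a]] := Bst true false.
have [b /= [nB0b B1b]] := Bst false true.
(* Whichever of [a] and [b] is smaller, upward closure puts the other one into a set that it
   avoids. *)
have [ba|nba] := pselect (R b a); last exact: nB0b (up0 _ _ B0a nba).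
apply: nB1a; apply: up1 B1b _ => ab; exact: Rirr (Rtrans _ _ _ ab ba).
Qed.

Section AlternatingChains.
Variable S : set X.

(** The condition on the [k]-th point of a chain; [alt 0], met by no chain point, is [S] itself. *)
Definition alt k : set X := if odd k then ~` S else S.

Lemma altS k a : alt k.+1 a <-> ~ alt k a.
Proof. by rewrite /alt /=; case: (odd k) => //=; split=> [? /(_ _)|/contrapT]. Qed.

(** This is U_k, with the chain unfolded from its top point; [~ R a b] reads b <= a. *)
Fixpoint alt_chain k : set X :=
  if k is j.+1 then [set a | exists b, [/\ ~ R a b, alt k b & alt_chain j b]]
  else setT.

Lemma alt_chain_upward_closed k : upward_closed (alt_chain k).
Proof.
case: k => // k a c [b [ab altb chb]] ca; exists b; split=> //.
exact: nlt_trans ab ca.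
Qed.

(* Along an alternating chain, each return to S meets a new convex piece, so
   the number of pieces meeting (-oo, a] grows. *)
Lemma alt_chain_bounded :
  finite_union_of_convex R S -> exists k, forall a, ~ alt_chain k a.
Proof.
have [_ _ Rtot] := Rlin.
move=> [k [I [Iconv SE]]].
pose P a := [set i : 'I_k | `[< exists2 w, I i w & ~ R a w >]]%SET.
(* Each return to [S] costs two points, so [k] pieces exclude chains of length [k.+1.*2]. *)
suff bound m a : alt_chain m.*2 a -> m <= #|P a|.
  exists k.+1.*2 => a /bound; rewrite leqNgt => /negP; apply.
  by rewrite ltnS (leq_trans (max_card _)) // card_ord.
elim: m a => // m IH a [c [nac altc [b [ncb altb /IH mP]]]].
move: altc altb; rewrite /alt /= odd_double /= => Sc nSb.
apply: leq_ltn_trans mP _; apply: proper_card; apply/properP; split.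
  apply/fintype.subsetP => i; rewrite !inE => -[w Iw nbw].
  by exists w => //; apply: nlt_trans (nlt_trans nbw ncb) nac.
(* The piece containing [c] is new: a point w <= b in it would, by convexity, put [b] into [S]. *)
move: (Sc); rewrite {1}SE => -[i _ Ic].
exists i; rewrite !inE; first by exists c.
apply/asboolP => -[w Iw nbw]; apply: (nSb); rewrite SE; exists i => //.
case: (Rtot b w) => // [->//|wb]; case: (Rtot b c) => // [bc|->//].
exact: Iconv Iw Ic wb bc.
Qed.

Fixpoint alt_combination N k : set X :=
  if N is N'.+1 then alt_chain k `&` ~` alt_combination N' k.+1 else alt_chain k.

(** A point of [alt_chain k] outside [alt k] can be appended to its own chain, hence lies in
    [alt_chain k.+1]; this drives the induction on [N]. *)
Lemma alt_combinationE N k a :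
  ~ alt_chain (k + N) a -> alt_combination N k a <-> alt_chain k a /\ alt k a.
Proof.
have [Rirr _ _] := Rlin; elim: N k => [|N IH] k /=; first by rewrite addn0; tauto.
rewrite addnS -addSn => /IH -> /=; rewrite altS.
have [altka|naltka] := pselect (alt k a); first tauto.
split=> [[cha []]|[] //]; split=> //.
by exists a; split=> //; apply/altS.
Qed.

End AlternatingChains.
End LinearOrder.

(** * Alternating chains expressed by formulas, and their uniform bound *)

Section AlternatingFormulas.
Variables (L : language) (lt : rel_symb L 2) (n : nat) (phi : formula L n.+1).

Definition falt k := if odd k then fneg phi else phi.

(* In the scope of the quantifier, ord0 is the new point of the chain and
   lift ord0 ord0 is x. *)
Fixpoint falt_chain k : formula L n.+1 :=
  if k is j.+1 then
    fex (fand (fneg (fatom lt (pair_args (tvar L (lift ord0 ord0)) (tvar L ord0))))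
          (fand (rename (rename_lift (lift ord0)) (falt k))
                (rename (rename_lift (lift ord0)) (falt_chain j))))
  else feq (tvar L ord0) (tvar L ord0).

Fixpoint falt_combination N k : formula L n.+1 :=
  if N is N'.+1 then fand (falt_chain k) (fneg (falt_combination N' k.+1))
  else falt_chain k.

Lemma boolean_combination_falt P N k :
  (forall j, P (falt_chain j)) -> boolean_combination P (falt_combination N k).
Proof.
move=> Pch; elim: N k => [|N IH] k /=; first exact: bc_base.
by apply: bc_and; [exact: bc_base | exact: bc_neg].
Qed.

Variables (M : structure L) (b : 'I_n -> M).
Let R := @rel2 L M lt.

Lemma fiber_falt k : fiber (falt k) b = alt (fiber phi b) k.
Proof. by rewrite /falt /alt; case: odd. Qed.

Lemma fiber_falt_chain k : fiber (falt_chain k) b = alt_chain R (fiber phi b) k.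
Proof.
elim: k => [|k IH]; first by apply/seteqP; split.
(* The renaming skips x, so [psi] is read at the new point [c] with the same parameters [b]. *)
have sat_chain_var a c psi :
    sat (scons c (scons a b)) (rename (rename_lift (lift ord0)) psi) <->
    fiber (M := M) psi b c.
  rewrite sat_rename scons_rename_lift /fiber /=.
  suff -> : scons a b \o lift ord0 = b by [].
  by apply/funext => i /=; rewrite sconsS.
have sat_lt_vars a c :
    rel_interp lt (fun i => eval (scons c (scons a b))
      (pair_args (tvar L (lift ord0 ord0)) (tvar L ord0) i)) = R a c.
  congr rel_interp; apply/funext => i; rewrite /pair_args.
  by case: eqP => _ /=; rewrite ?sconsS scons0.
rewrite /= -IH -fiber_falt; apply/seteqP; split=> a [c] /=; rewrite ?sat_lt_vars.
  by move=> [nac [/sat_chain_var altc /sat_chain_var chc]]; exists c.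
move=> [nac altc chc]; exists c => /=; rewrite sat_lt_vars.
by split=> //; split; apply/sat_chain_var.
Qed.

Lemma sat_falt_chain k a :
  sat (scons a b) (falt_chain k) = alt_chain R (fiber phi b) k a.
Proof. by rewrite -fiber_falt_chain. Qed.

Lemma fiber_falt_combination N k :
  fiber (falt_combination N k) b = alt_combination R (fiber phi b) N k.
Proof.
elim: N k => [|N IH] k /=; first exact: fiber_falt_chain.
by rewrite -fiber_falt_chain -IH.
Qed.

End AlternatingFormulas.

(** Without a bound, compactness yields one [b] whose fiber has chains of every length; the
    conditions decrease in [k] because dropping the top point leaves a shorter chain. *)
Lemma falt_chain_uniformly_bounded (L : language) (T : theory L) (C : structure L)
    (lt : rel_symb L 2) n (phi : formula L n.+1) :
  monster_model T C -> strict_linear_order (@rel2 L C lt) ->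
  (forall b : 'I_n -> C, finite_union_of_convex (@rel2 L C lt) (fiber phi b)) ->
  exists N, forall v : 'I_n.+1 -> C, ~ sat v (falt_chain lt phi N).
Proof.
move=> Cmonster Rlin phi_fin; apply: contrapT => /forallNP unbounded.
have [|k|b bP] := @monster_compactness _ _ _ n
  (fun k => fex (falt_chain lt phi k)) Cmonster.
- move=> k b [a]; rewrite -/(sat _ _) sat_falt_chain => -[c [_ _ chc]].
  by exists c; rewrite sat_falt_chain.
- have /existsNP[v /contrapT] := unbounded k.
  rewrite (scons_eta v) => ?.
  by exists (fun i => v (lift ord0 i)), (v ord0).
- have [k kP] := alt_chain_bounded Rlin (phi_fin b).
  by have [a] := bP k; rewrite -/(sat _ _) sat_falt_chain => /kP.
Qed.

Theorem proposition3p11 (L : language) (T : theory L) (C : structure L) :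
  complete_theory T ->
  monster_model T C ->
  weakly_o_minimal T ->
  fully_VC_minimal T C.
Proof.
move=> Tcomplete Cmonster [lt wom].
have TC := Cmonster.1; have [Clin Cfin] := wom C TC.
exists (fun n psi => forall b : 'I_n -> C,
  upward_closed (@rel2 L C lt) (fiber psi b)); split.
  apply: (upward_closed_independence_dimension Clin) => S.
  by move=> [n [psi [b [psi_up ->]]]].
move=> n phi.
have [b|N NP] := falt_chain_uniformly_bounded (phi := phi) Cmonster Clin.
  by apply: Cfin; exists n, phi, b.
exists (falt_combination lt phi N 0); split.
  apply: boolean_combination_falt => k b.
  by rewrite fiber_falt_chain; exact: alt_chain_upward_closed.
move=> M TM v; have [Mlin _] := wom M TM.
have := complete_theory_transfer Tcomplete TC TM NP (v := v).
rewrite (scons_eta v); set a := v ord0; set b := fun i => _.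
rewrite -[sat _ (falt_combination _ _ _ _)]
  /(fiber (falt_combination lt phi N 0) b a).
rewrite sat_falt_chain fiber_falt_combination -[N in alt_chain _ _ N]add0n.
(* At [k = 0] the chain condition is void and [alt 0] is the fiber of [phi]. *)
by move=> /(alt_combinationE Mlin) -> /=; tauto.
Qed.
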